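(* For every $n\in\{2,3,\ldots,\omega\}$, the class of all finite $n$-partite tournaments has EPPA (the extension property for partial automorphisms).
   Context: A directed graph is a structure with one binary relation which is irreflexive and antisymmetric (no loops, no bi-directional edges). Substructures are induced, and embeddings are injective maps preserving the relation in both directions. Given $n\in\{2,3,\ldots,\omega\}$, a directed graph $\mathbf A$ is an $n$-partite tournament if its vertex set can be partitioned into (possibly empty) pairwise disjoint sets $A_1\cup A_2\cup\cdots\cup A_n=A$ (countably many sets $A_1,A_2,\ldots$ if $n=\omega$), called parts, such that every pair of vertices in different parts is connected by a directed edge (in exactly one direction) and there are no edges between vertices in the same part. The parts are not named by the language. A class $\mathcal C$ of structures has EPPA if for every $\mathbf A\in\mathcal C$ there exists $\mathbf B\in\mathcal C$ containing $\mathbf A$ as a substructure such that every isomorphism between two substructures of $\mathbf A$ (a partial automorphism of $\mathbf A$) extends to an automorphism of $\mathbf B$. *)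

(* Defs.v *)
From HB Require Import structures.
From mathcomp Require Import all_boot.

Set Implicit Arguments.
Unset Strict Implicit.
Unset Printing Implicit Defensive.

Record digraph := Digraph {
  vertex :> finType;
  edge : rel vertex;
  edge_irr : irreflexive edge;
  edge_anti : antisymmetric edge
}.

Section Induced.
Variables (A : digraph) (S : {set A}).

Definition induced_edge : rel {x : A | x \in S} :=
  fun x y => edge (val x) (val y).

Lemma induced_irr : irreflexive induced_edge.
Proof. by move=> x; apply: edge_irr. Qed.

Lemma induced_anti : antisymmetric induced_edge.
Proof. by move=> x y /edge_anti /val_inj. Qed.

Definition induced : digraph := Digraph induced_irr induced_anti.

End Induced.

Definition is_embedding (A B : digraph) (f : A -> B) : Prop :=
  injective f /\ forall x y : A, edge (f x) (f y) = edge x y.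

Definition is_isomorphism (A B : digraph) (f : A -> B) : Prop :=
  is_embedding f /\ bijective f.

Definition is_automorphism (B : digraph) (g : B -> B) : Prop :=
  is_isomorphism g.

(* "B contains A as a substructure" is rendered by an embedding iota of A into
   B; a partial automorphism of A is an isomorphism phi between the
   substructures induced on two vertex sets S and S'. *)
Definition EPPA (C : digraph -> Prop) : Prop :=
  forall A : digraph, C A ->
  exists B : digraph, C B /\
  exists iota : A -> B, is_embedding iota /\
  forall (S S' : {set A}) (phi : induced S -> induced S'),
    is_isomorphism phi ->
    exists g : B -> B, is_automorphism g /\
      forall x : induced S, g (iota (val x)) = iota (val (phi x)).

Inductive part_number := Fin of nat | Omega.

Definition at_least_two (n : part_number) : Prop :=
  match n with Fin k => 2 <= k | Omega => True end.

Definition part_index (n : part_number) : Type :=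
  match n with Fin k => 'I_k | Omega => nat end.

(* The parts are existentially quantified and not part of the structure, so
   embeddings and automorphisms need not respect their indexing. *)
Definition partite_tournament (n : part_number) (A : digraph) : Prop :=
  exists P : part_index n -> {set A},
    [/\ forall x : A, exists i, x \in P i,
        forall i j, i <> j -> [disjoint P i & P j],
        forall i j (x y : A), i <> j -> x \in P i -> y \in P j ->
          edge x y (+) edge y x
      & forall i (x y : A), x \in P i -> y \in P i -> ~~ edge x y].

(* Main.v *)
Require Import Defs.
From mathcomp Require Import all_boot all_fingroup.

(** Write the parts of A as the fibres of a map p : A -> 'I_m.  A vertex of the
    extension is a point x of the grid 'I_m * A with a valuation, an arbitrary
    boolean function on the grid; its part is the first coordinate of x.  The
    edge between (x, f) and (y, g) is oriented by the parity of f y + g x,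
    corrected by the order of the parts of x and y.  A partial automorphism of
    A preserves "being in the same part", so it extends to a permutation of the
    grid that respects the parts.  This permutation acts on the vertices once
    we also flip the values f y by bits F x y, where F x y + F y x is prescribed.
    If x comes from the domain of the partial automorphism, then the requirement
    to extend it determines F x y for all y; these requirements are compatible
    because the partial automorphism preserves edges. *)

Set Implicit Arguments.
Unset Strict Implicit.
Unset Printing Implicit Defensive.

Lemma perm_extension (U T : finType) (g h : U -> T) :
    (forall u v, (g u == g v) = (h u == h v)) ->
  exists s : {perm T}, forall u, s (g u) = h u.
Proof.
move=> gh; suff [s sP] : exists s : {perm T}, {in enum U, forall u, s (g u) = h u}.
  by exists s => u; apply: sP; rewrite mem_enum.
elim: (enum U) => [|u l [s IHs]]; first by exists 1%g.
(* The transposition corrects the value at [g u]; it fixes [h v] whenever [g v] differs from [g u],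
   so earlier values survive. *)
exists (s * tperm (s (g u)) (h u))%g => v; rewrite inE permM.
case: (eqVneq (g v) (g u)) => [gvu | gvu].
  by have := gh v u; rewrite gvu eqxx => /esym/eqP -> _; rewrite tpermL.
case/orP => [/eqP vu|/IHs sv]; first by rewrite vu eqxx in gvu.
rewrite sv tpermD //; last by rewrite eq_sym -gh.
by rewrite -sv (inj_eq perm_inj) eq_sym.
Qed.

(** Inside a fibre of [p] the zero sum leaves no edges, since antisymmetry and irreflexivity exclude
    two opposite ones. *)
Definition parted (I : eqType) (A : digraph) (p : A -> I) :=
  forall x y : A, edge x y (+) edge y x = (p x != p y).

Lemma parted_edge (I : eqType) (A : digraph) (p : A -> I) :
  parted p -> forall x y, p x = p y -> edge x y = false.
Proof.
move=> pP x y pxy; have := pP x y; rewrite pxy eqxx.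
case Exy: (edge x y); case Eyx: (edge y x) => //= _.
by have /edge_anti xy : edge x y && edge y x; [rewrite Exy | rewrite xy edge_irr in Exy].
Qed.

Lemma parted_partite (n : part_number) (m : nat) (h : 'I_m -> part_index n)
    (A : digraph) (p : A -> 'I_m) :
  injective h -> parted p -> partite_tournament n A.
Proof.
(* [part_index n] is a bare [Type]; its equality is decided by cases on [n]. *)
pose dec (i j : part_index n) : bool :=
  match n return part_index n -> part_index n -> bool with
  | Fin k => fun i j => i == j | Omega => fun i j => i == j end i j.
have decP i j : reflect (i = j) (dec i j).
  by rewrite /dec; case: (n) i j => [k|] i j; apply: eqP.
move=> hI pP; exists (fun i => [set x | dec (h (p x)) i]); split.
- by move=> x; exists (h (p x)); rewrite inE; apply/decP.
- move=> i j ij; rewrite -setI_eq0; apply/eqP/setP => x; rewrite !inE.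
  by apply/negP => /andP[/decP xi /decP xj]; apply: ij; rewrite -xi.
- move=> i j x y ij; rewrite !inE pP => /decP xi /decP yj.
  by apply/eqP => pxy; apply: ij; rewrite -xi pxy.
- move=> i x y; rewrite !inE => /decP xi /decP yi.
  by rewrite (parted_edge pP) //; apply: hI; rewrite xi.
Qed.

Lemma partite_parted (n : part_number) (A : digraph) :
    partite_tournament n A ->
  exists m (h : 'I_m -> part_index n) (p : A -> 'I_m), injective h /\ parted p.
Proof.
have fibre (I : eqType) (P : I -> {set A}) (q : A -> I) :
    (forall x, x \in P (q x)) ->
    (forall i j (x y : A), i <> j -> x \in P i -> y \in P j ->
      edge x y (+) edge y x) ->
    (forall i (x y : A), x \in P i -> y \in P i -> ~~ edge x y) -> parted q.
  move=> qP cross same x y; case: eqVneq => [qxy | /eqP qxy].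
    have := qP y; rewrite -qxy => yP.
    by rewrite (negbTE (same _ _ _ (qP x) yP)) (negbTE (same _ _ _ yP (qP x))).
  exact: cross qxy (qP x) (qP y).
case: n => [k|] [P [cover _ cross same]] /=.
  have coverb x : exists i, x \in P i by apply: cover.
  exists k, id, (fun x => xchoose (coverb x)); split=> //.
  exact: (fibre _ P _ (fun x => xchooseP (coverb x))).
have coverb x : exists i, x \in P i by apply: cover.
pose q x := xchoose (coverb x).
have qP : parted q by apply: (fibre _ P _ (fun x => xchooseP (coverb x))).
(* [A] is finite, so even for [Omega] the part indices in use are bounded. *)
pose m := \max_(x : A) q x.
have qm x : q x < m.+1 by rewrite ltnS leq_bigmax.
by exists m.+1, val, (fun x => Ordinal (qm x)); split=> //; apply: val_inj.
Qed.

Section Valuations.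
Variables (m : nat) (T : finType).
Let X := ('I_m * T)%type.
Let V := (X * {ffun X -> bool})%type.
Implicit Types (x y z : X) (u v : V).

Definition valuation_edge : rel V := fun u v =>
  (u.1.1 != v.1.1) && (u.2 v.1 (+) v.2 u.1 (+) (u.1.1 < v.1.1)).

Lemma ltn_ord_asym (i j : 'I_m) : i != j -> (j < i) = ~~ (i < j).
Proof. by rewrite -leqNgt [RHS]leq_eqVlt -val_eqE eq_sym => /negbTE ->. Qed.

(** The sum of the two valuation bits is symmetric in [u] and [v], so the order term alone separates
    the two directions. *)
Lemma valuation_edge_xor u v :
  valuation_edge u v (+) valuation_edge v u = (u.1.1 != v.1.1).
Proof.
rewrite /valuation_edge [v.1.1 == _]eq_sym; case: (boolP (u.1.1 == _)) => //= uv.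
rewrite (ltn_ord_asym uv).
by case: (u.2 _); case: (v.2 _); case: (_ < _).
Qed.

Lemma valuation_irr : irreflexive valuation_edge.
Proof. by move=> u; rewrite /valuation_edge eqxx. Qed.

Lemma valuation_anti : antisymmetric valuation_edge.
Proof.
move=> u v /andP[uv vu]; have := valuation_edge_xor u v.
by rewrite uv vu; case/andP: uv => ->.
Qed.

Definition valuation_graph : digraph := Digraph valuation_irr valuation_anti.

Section Twist.
Variables (s : {perm 'I_m}) (t : {perm T}) (F : X -> X -> bool).

Definition grid_perm x : X := (s x.1, t x.2).
Definition grid_perm_inv x : X := ((s^-1)%g x.1, (t^-1)%g x.2).

Lemma grid_permK : cancel grid_perm grid_perm_inv.
Proof. by case=> i a; rewrite /grid_perm_inv /= !permK. Qed.

(** The change of the order term of [valuation_edge] under [s], which the flips have to cancel. *)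
Definition order_defect x y := (x.1 < y.1) (+) (s x.1 < s y.1).

Lemma order_defectC x y : x.1 != y.1 -> order_defect y x = order_defect x y.
Proof.
move=> xy; have sxy : s x.1 != s y.1 by rewrite (inj_eq perm_inj).
rewrite /order_defect (ltn_ord_asym xy) (ltn_ord_asym sxy).
by rewrite addbN addNb negbK.
Qed.

Definition twist (u : valuation_graph) : valuation_graph :=
  (grid_perm u.1,
   [ffun z => u.2 (grid_perm_inv z) (+) F u.1 (grid_perm_inv z)]).

Lemma twist_automorphism :
    (forall x y, x.1 != y.1 -> F x y (+) F y x = order_defect x y) ->
  is_automorphism twist.
Proof.
move=> FE; have twist_inj : injective twist.
  move=> [x f] [y g] [] /perm_inj exy1 /perm_inj exy2 /ffunP fg.
  have exy : x = y by rewrite [x]surjective_pairing exy1 exy2 -surjective_pairing.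
  rewrite -exy in fg *; congr (_, _); apply/ffunP => z.
  by have := fg (grid_perm z); rewrite !ffunE grid_permK => /addIb.
split; last exact: injF_bij.
split=> // u v; rewrite /= /valuation_edge /= (inj_eq perm_inj).
case: eqVneq => //= uv; rewrite !ffunE !grid_permK.
have := FE _ _ uv; rewrite /order_defect.
by case: (F u.1 _); case: (F v.1 _); case: (u.2 _); case: (v.2 _);
   case: (_ < _); case: (_ < _).
Qed.

End Twist.

Lemma twist_extension (U : finType) (w w' : U -> valuation_graph) :
    injective (fun a => (w a).1.2) -> injective (fun a => (w' a).1.2) ->
    (forall a b, edge (w' a) (w' b) = edge (w a) (w b)) ->
  exists g : valuation_graph -> valuation_graph,
    is_automorphism g /\ forall a, g (w a) = w' a.
Proof.
move=> wI w'I ww'.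
have [t tP] : exists t : {perm T}, forall a, t (w a).1.2 = (w' a).1.2.
  by apply: perm_extension => a b; rewrite (inj_eq wI) (inj_eq w'I).
have [s sP] : exists s : {perm 'I_m}, forall a, s (w a).1.1 = (w' a).1.1.
  (* Being in the same part can be read off the edges, on which [w] and [w'] agree. *)
  apply: perm_extension => a b; apply: negb_inj.
  rewrite -!valuation_edge_xor.
  by have := ww' a b; have := ww' b a; rewrite /= => -> ->.
have pP a : grid_perm s t (w a).1 = (w' a).1.
  by rewrite /grid_perm sP tP -surjective_pairing.
pose flip a y := (w a).2 y (+) (w' a).2 (grid_perm s t y).
pose E := order_defect s.
(* Rows of [F] over the range of [w] are forced by [flip]; columns over that range then follow from
   the prescribed sum. For a pair outside the range, the order with the earlier part first carries
   the whole defect. *)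
pose F x y := match [pick a | (w a).1 == x], [pick b | (w b).1 == y] with
  | Some a, _ => flip a y
  | None, Some b => flip b x (+) E x y
  | None, None => (x.1 < y.1) && E x y
  end.
have FE x y : x.1 != y.1 -> F x y (+) F y x = E x y.
  rewrite /F => xy; have EC := order_defectC s xy.
  case: pickP => [a /eqP wax|_]; case: pickP => [b /eqP wby|_].
  - have := ww' a b; rewrite /= /valuation_edge -!sP (inj_eq perm_inj) wax wby xy /=.
    rewrite /flip /E /order_defect -!pP wax wby.
    by case: ((w a).2 _); case: ((w b).2 _); case: ((w' a).2 _);
       case: ((w' b).2 _); case: (_ < _); case: (_ < _).
  - by rewrite /E EC addbA addbb addFb.
  - by rewrite addbAC addbb addFb.
  - rewrite /E EC (ltn_ord_asym xy).
    by case: (_ < _); rewrite /= ?addbF.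
exists (twist s t F); split; first exact: twist_automorphism.
move=> a; rewrite /twist pP [RHS]surjective_pairing; congr (_, _).
apply/ffunP => z; rewrite ffunE.
(* [pick] can only return [a], as the grid points of [w] are distinct. *)
have Fa y : F (w a).1 y = flip a y.
  rewrite /F; case: pickP => [b /eqP ba|/(_ a)]; last by rewrite eqxx.
  by have -> : b = a by apply: wI; rewrite /= ba.
rewrite Fa /flip addbA addbb addFb; congr ((w' a).2 _).
by case: z => i b; rewrite /grid_perm /grid_perm_inv /= !permKV.
Qed.

End Valuations.

Section Embedding.
Variables (m : nat) (A : digraph) (p : A -> 'I_m).

(* Of the two bits that orient an edge, the vertex in the later part carries
   the information. *)
Definition graph_valuation (x : A) : valuation_graph m A :=
  ((p x, x), [ffun y : 'I_m * A => (y.1 < p x) && edge x y.2]).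

(** If [x] lies in the earlier part, the valuation of [y] contributes [edge y x], and the order term
    negates it to [edge x y]. *)
Lemma graph_valuation_embedding : parted p -> is_embedding graph_valuation.
Proof.
move=> pP; split=> [x y [] //|x y].
rewrite /= /valuation_edge /= !ffunE /=.
case: eqVneq => [pxy | pxy] /=; first by rewrite (parted_edge pP).
have := pP x y; rewrite (ltn_ord_asym pxy) pxy.
by case: (edge x y); case: (edge y x); case: (_ < _).
Qed.

End Embedding.

Theorem theorem1p1 (n : part_number) (hn : at_least_two n) :
  EPPA (partite_tournament n).
Proof.
move=> A /partite_parted[m [h [p [hI pP]]]].
exists (valuation_graph m A); split.
  (* The extension has the same part labels as [A], so [h] serves again. *)
  apply: (@parted_partite _ _ h _ (fun u : valuation_graph m A => u.1.1)) => //.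
  exact: valuation_edge_xor.
have [iotaI iotaE] := graph_valuation_embedding pP.
exists (graph_valuation p); split=> // S S' phi [[phiI phiE] _].
apply: (twist_extension (w := fun x : induced S => graph_valuation p (val x))
  (w' := fun x : induced S => graph_valuation p (val (phi x)))).
- by move=> x y /val_inj.
- by move=> x y /val_inj/phiI.
- by move=> x y; rewrite !iotaE; apply: phiE.
Qed.
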